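(* Let $\Gamma$ be a general network and let $\delta$ be the congruence on $\mathcal{L}(\Gamma)$ relating two elements exactly when they have the same tensor set. Then each $\delta$-class of $\mathcal{L}(\Gamma)$ contains a unique local maximum element.
   Context: A general network $\Gamma$ has a finite vertex set $\Gamma^0$ and a finite set $T$ of tensors. A tensor $t=T_A^B$ is given by a non-empty set $A\subseteq\Gamma^0$ of covariant indexes and a (possibly empty) set $B\subseteq\Gamma^0$ of contra-variant indexes; its index set is $I(t)=A\cup B$. A 2-chain is an unordered pair $\oplus(t_i,t_j)$ of distinct tensors $t_i,t_j\in T$ with $I(t_i)\cap I(t_j)\neq\emptyset$. A (non-empty) tensor chain is $\oplus(P|S)$, where $P\subseteq T$ is non-empty, $S$ is a set of 2-chains between elements of $P$, and the pair is connected: any two distinct $t_i,t_j\in P$ are joined by a sequence $t_i=t_{k_1},\dots,t_{k_m}=t_j$ in $P$ with $\oplus(t_{k_\ell},t_{k_{\ell+1}})\in S$ for all $1\le \ell<m$. A tensor chain is determined by $(P,S)$; a single tensor $t$ is the chain with $P=\{t\}$, $S=\varnothing$. $\mathcal{L}(\Gamma)$ is the set of all non-empty tensor chains together with an extra element $\emptyset$ (the empty relation), whose tensor set is regarded as empty. Reducing: for non-empty chains $l_1=\oplus(P_1|S_1)$, $l_2=\oplus(P_2|S_2)$, put $l_1\mathring{\cup}l_2=\oplus(P_1\cup P_2|S_1\cup S_2)$ if $P_1\cap P_2\neq\varnothing$ and $l_1\mathring{\cup}l_2=\emptyset$ otherwise; also $\emptyset\mathring{\cup}l=l\mathring{\cup}\emptyset=\emptyset$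 for all $l$. Partial order: $l_1\preceq l_2$ if $l_1\mathring{\cup}l_2=l_2$. $l\delta$ denotes the $\delta$-class of $l$. An element $l\in\mathcal{L}(\Gamma)$ is a local maximum element of $l\delta$ if $l'\preceq l$ for every $l'\in l\delta$. *)

(* Defs.v *)
From HB Require Import structures.
From mathcomp Require Import all_boot.

Set Implicit Arguments.
Unset Strict Implicit.
Unset Printing Implicit Defensive.

(* Tensors form an abstract finite type carrying their index sets, so that two
   different tensors may have the same covariant and contra-variant indexes. *)
Record network := Network {
  vertex : finType;
  tensor : finType;
  covariant : tensor -> {set vertex};
  contravariant : tensor -> {set vertex};
  covariant_neq0 : forall t, covariant t != set0
}.

Definition index_set (G : network) (t : tensor G) : {set vertex G} :=
  covariant t :|: contravariant t.

(* The unordered pair of t1 and t2 is encoded as [set t1; t2]. *)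
Definition is_two_chain (G : network) (s : {set tensor G}) : bool :=
  [exists t1 : tensor G, exists t2 : tensor G,
    [&& t1 != t2, index_set t1 :&: index_set t2 != set0 & s == [set t1; t2]]].

Definition linked (G : network) (P : {set tensor G}) (S : {set {set tensor G}})
    : rel (tensor G) :=
  [rel t1 t2 | [&& t1 \in P, t2 \in P & [set t1; t2] \in S]].

Definition is_chain (G : network)
    (PS : {set tensor G} * {set {set tensor G}}) : bool :=
  [&& PS.1 != set0,
      [forall s in PS.2, is_two_chain s && (s \subset PS.1)]
    & [forall t1 in PS.1, forall t2 in PS.1,
        (t1 != t2) ==> connect (linked PS.1 PS.2) t1 t2]].

Record chain (G : network) := Chain {
  chain_val : {set tensor G} * {set {set tensor G}};
  chain_valP : is_chain chain_val
}.

HB.instance Definition _ (G : network) := [isSub for @chain_val G].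
HB.instance Definition _ (G : network) := [Finite of chain G by <:].

Definition chain_tensors (G : network) (c : chain G) : {set tensor G} :=
  (chain_val c).1.

Definition chain_links (G : network) (c : chain G) : {set {set tensor G}} :=
  (chain_val c).2.

Lemma is_chainU (G : network) (c1 c2 : chain G) :
  chain_tensors c1 :&: chain_tensors c2 != set0 ->
  is_chain (chain_tensors c1 :|: chain_tensors c2,
            chain_links c1 :|: chain_links c2).
Proof.
case: c1 c2 => [[P1 S1] H1] [[P2 S2] H2]; rewrite /chain_tensors /chain_links /=.
case/and3P: H1 H2 => /= _ /forall_inP s1 c1 /and3P[/= _ /forall_inP s2 c2].
case/set0Pn => t0 /setIP[t01 t02].
have sub1 : subrel (linked P1 S1) (linked (P1 :|: P2) (S1 :|: S2)).
  move=> x y /and3P[xP yP xyS].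
  by apply/and3P; split; apply/setUP; left.
have sub2 : subrel (linked P2 S2) (linked (P1 :|: P2) (S1 :|: S2)).
  move=> x y /and3P[xP yP xyS].
  by apply/and3P; split; apply/setUP; right.
have mono e : subrel e (linked (P1 :|: P2) (S1 :|: S2)) ->
    subrel (connect e) (connect (linked (P1 :|: P2) (S1 :|: S2))).
  by move=> es; apply: connect_sub => x y /es; apply: connect1.
have con1 x y : x \in P1 -> y \in P1 ->
    connect (linked (P1 :|: P2) (S1 :|: S2)) x y.
  move=> xP yP; case: (eqVneq x y) => [->|nxy]; first exact: connect0.
  apply: (mono _ sub1).
  by move/forall_inP: c1 => /(_ _ xP)/forall_inP/(_ _ yP); rewrite nxy.
have con2 x y : x \in P2 -> y \in P2 ->
    connect (linked (P1 :|: P2) (S1 :|: S2)) x y.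
  move=> xP yP; case: (eqVneq x y) => [->|nxy]; first exact: connect0.
  apply: (mono _ sub2).
  by move/forall_inP: c2 => /(_ _ xP)/forall_inP/(_ _ yP); rewrite nxy.
apply/and3P; split=> /=.
- by apply/set0Pn; exists t0; rewrite inE t01.
- apply/forall_inP => s /setUP[sS|sS].
    have /andP[-> sP] := s1 s sS.
    exact: subset_trans sP (subsetUl _ _).
  have /andP[-> sP] := s2 s sS.
  exact: subset_trans sP (subsetUr _ _).
- apply/forall_inP => x xP; apply/forall_inP => y yP; apply/implyP => _.
  apply: (@connect_trans _ _ t0).
    by case/setUP: xP => xP; [apply: con1 | apply: con2].
  by case/setUP: yP => yP; [apply: con1 | apply: con2].
Qed.

(* [None] is the empty relation. *)
Definition chains (G : network) : Type := option (chain G).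
HB.instance Definition _ (G : network) := Finite.on (chains G).

Definition tensors (G : network) (l : chains G) : {set tensor G} :=
  if l is Some c then chain_tensors c else set0.

Definition reduce (G : network) (l1 l2 : chains G) : chains G :=
  match l1, l2 with
  | Some c1, Some c2 =>
      match @idP (chain_tensors c1 :&: chain_tensors c2 != set0) with
      | ReflectT meet12 => Some (Chain (is_chainU meet12))
      | ReflectF _ => None
      end
  | _, _ => None
  end.

Definition chain_le (G : network) (l1 l2 : chains G) : bool :=
  reduce l1 l2 == l2.

Definition delta (G : network) : rel (chains G) :=
  [rel l1 l2 | tensors l1 == tensors l2].

Definition delta_class (G : network) (l : chains G) : {set chains G} :=
  [set l' | delta l l'].

Definition local_max (G : network) (l : chains G) : Prop :=
  forall l', l' \in delta_class l -> chain_le l' l.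

Lemma tensors_reduce (G : network) (l1 l2 : chains G) :
  tensors (reduce l1 l2) =
  if tensors l1 :&: tensors l2 == set0 then set0 else tensors l1 :|: tensors l2.
Proof.
case: l1 l2 => [c1|] [c2|] /=; rewrite ?setI0 ?set0I ?eqxx //.
by case: {-}_ / idP => [|/negP/negPn] h /=; [rewrite (negPf h) | rewrite h].
Qed.

Lemma delta_equivalence (G : network) : equivalence_rel (@delta G).
Proof. by move=> x y z; rewrite /delta /= eqxx; split=> // /eqP->. Qed.

Lemma delta_congruence (G : network) (l1 l1' l2 l2' : chains G) :
  delta l1 l1' -> delta l2 l2' -> delta (reduce l1 l2) (reduce l1' l2').
Proof. by move=> /eqP e1 /eqP e2; rewrite /delta /= !tensors_reduce e1 e2. Qed.

(* Main.v *)
(** Enlarging the link set of a chain keeps it connected, so a delta-class of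
    non-empty chains with tensor set [P] contains the chain linking every pair
    of distinct elements of [P] with intersecting index sets.  Within one class
    the order is inclusion of link sets, hence antisymmetric, and this chain is
    the greatest element. *)
Require Import Defs.
From mathcomp Require Import all_boot.

Lemma chain_tensors_neq0 (G : network) (c : chain G) : chain_tensors c != set0.
Proof. by have /and3P[] := chain_valP c. Qed.

(** Tensor sets of chains are non-empty, so equal ones meet and [reduce] takes unions; only the
    links remain to be compared. *)
Lemma chain_le_links (G : network) (c1 c2 : chain G) :
  chain_tensors c1 = chain_tensors c2 ->
  chain_le (Some c1) (Some c2) = (chain_links c1 \subset chain_links c2).
Proof.
move=> eqT.
rewrite /chain_le /=; case: {-}_ / idP => [meet12|[]]; last first.
  by rewrite eqT setIid chain_tensors_neq0.
(* Chains form a subtype, so their equality is decided on the underlying pairs. *)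
rewrite [LHS](_ : _ = ((chain_tensors c1 :|: chain_tensors c2,
  chain_links c1 :|: chain_links c2) == chain_val c2)) //.
rewrite [chain_val c2]surjective_pairing xpair_eqE eqT setUid eqxx /=.
exact: (sameP eqP setUidPr).
Qed.

Definition full_links (G : network) (P : {set tensor G}) :
    {set {set tensor G}} :=
  [set s | is_two_chain s && (s \subset P)].

Lemma chain_links_full (G : network) (c : chain G) :
  chain_links c \subset full_links G (chain_tensors c).
Proof.
have /and3P[_ /forall_inP linksP _] := chain_valP c.
by apply/subsetP => s /linksP; rewrite inE.
Qed.

(** Connectedness can fail for an arbitrary tensor set; here the paths are inherited from the links
    of [c]. *)
Lemma is_chain_full (G : network) (c : chain G) :
  is_chain (chain_tensors c, full_links G (chain_tensors c)).
Proof.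
have /and3P[P_neq0 _ /forall_inP conP] := chain_valP c.
apply/and3P; split=> //=; first by apply/forall_inP => s; rewrite inE.
apply/forall_inP => x xP; apply/forall_inP => y yP; apply/implyP => neq_xy.
have /forall_inP/(_ y yP) := conP x xP; rewrite neq_xy /=.
apply: connect_sub => u v /and3P[uP vP uvS]; apply: connect1.
by apply/and3P; split=> //; apply: (subsetP (chain_links_full G c)).
Qed.

Lemma chain_le_delta_anti (G : network) (l1 l2 : chains G) :
  delta l1 l2 -> chain_le l1 l2 -> chain_le l2 l1 -> l1 = l2.
Proof.
case: l1 l2 => [c1|] [c2|] // /eqP eqT; rewrite !chain_le_links // => le12 le21.
congr Some; apply: val_inj; rewrite /= [LHS]surjective_pairing.
rewrite [RHS]surjective_pairing.
by congr pair => //; apply/eqP; rewrite eqEsubset le12.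
Qed.

Lemma local_max_exists (G : network) (l : chains G) :
  exists2 m : chains G, m \in delta_class l & local_max m.
Proof.
case: l => [c|].
  exists (Some (Chain (is_chain_full G c))); first by rewrite inE /delta /=.
  move=> [c'|]; rewrite inE /delta /= => /eqP.
    rewrite [chain_tensors (Chain _)]/chain_tensors /= => eqT.
    by rewrite chain_le_links // /chain_links /= eqT; apply: chain_links_full.
  by move=> P_eq0; case/negP: (chain_tensors_neq0 G c); apply/eqP.
(* [None] absorbs under [reduce], so every element lies below it. *)
by exists None; [rewrite inE /delta /= | case].
Qed.

Theorem proposition4p3 (G : network) (l : chains G) :
  exists! m : chains G, m \in delta_class l /\ local_max m.
Proof.
have [m m_l m_max] := local_max_exists G l.
exists m; split=> // m' [m'_l m'_max].
have delta_mm' : delta m m'.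
  by move: m_l m'_l; rewrite !inE /delta /= => /eqP <- /eqP <-.
(* Two local maxima of one class lie below each other. *)
apply: chain_le_delta_anti => //.
  by apply: m'_max; rewrite inE /delta /= eq_sym.
by apply: m_max; rewrite inE.
Qed.
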